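(* Let $\nu$ be a positive locally finite measure on $\mathbb{R}^d$ with $\nu\not\equiv 0$. Then $\nu$ is uniformly spread over $\mathbb{R}^d$ (that is, there is $\beta>0$ such that $\mathrm{Tra}(\nu,\beta\omega)<\infty$, where $\omega$ is the Lebesgue measure on $\mathbb{R}^d$) if and only if there exists a constant $C<\infty$ such that $$\mathrm{Tra}(\nu,\nu^z)<C\qquad\text{for all } z\in\mathbb{R}^d.$$
   Context: Measures are Borel measures; $|\cdot|$ is the Euclidean norm on $\mathbb{R}^d$. For a measure $\nu$ on $\mathbb{R}^d$ and $z\in\mathbb{R}^d$, $\nu^z$ denotes the shift (translate) of $\nu$ along $z$, i.e. $\nu^z(E)=\nu(E-z)$ for Borel $E\subset\mathbb{R}^d$. For locally finite positive measures $\nu_1,\nu_2$ on $\mathbb{R}^d$, a transportation measure between $\nu_1$ and $\nu_2$ is a positive measure $\gamma$ on $\mathbb{R}^d\times\mathbb{R}^d$ such that $$\iint_{\mathbb{R}^d\times\mathbb{R}^d}\varphi(x)\,d\gamma(x,y)=\int_{\mathbb{R}^d}\varphi(x)\,d\nu_1(x),\qquad \iint_{\mathbb{R}^d\times\mathbb{R}^d}\varphi(y)\,d\gamma(x,y)=\int_{\mathbb{R}^d}\varphi(y)\,d\nu_2(y)$$ for all continuous functions $\varphi:\mathbb{R}^d\to\mathbb{R}$ with compact support. The transportation distance is $$\mathrm{Tra}(\nu_1,\nu_2)=\inf_\gamma\,\sup\{|x-y|:\ (x,y)\in\overline{\mathrm{supp}\,\gamma}\},$$ where the infimum is taken over all transportation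 measures $\gamma$ between $\nu_1$ and $\nu_2$ (with the usual convention that the infimum over the empty set is $+\infty$). A locally finite positive measure $\nu$ on $\mathbb{R}^d$ is called uniformly spread over $\mathbb{R}^d$ if there is $\beta>0$ such that $\mathrm{Tra}(\nu,\beta\omega)<\infty$, where $\omega$ is the Lebesgue measure on $\mathbb{R}^d$. *)

(* Defs.v *)
From HB Require Import structures.
From mathcomp Require Import all_boot all_order all_algebra.
From mathcomp Require Import interval_inference.
From mathcomp Require Import all_classical all_reals all_analysis.
Set Implicit Arguments.
Unset Strict Implicit.
Unset Printing Implicit Defensive.
Import Order.TTheory GRing.Theory Num.Theory.
Import numFieldNormedType.Exports.
Local Open Scope classical_set_scope.
Local Open Scope ring_scope.

(* provides the ptopologicalType instance of products *)
HB.saturate prod.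

Notation borel T := (@g_sigma_algebraType T%type open).

Lemma borel_open (T : ptopologicalType) (U : set T) :
  open U -> measurable (U : set (borel T)).
Proof. by move=> oU; exact: sub_sigma_algebra. Qed.

Lemma borel_closed (T : ptopologicalType) (F : set T) :
  closed F -> measurable (F : set (borel T)).
Proof.
by move=> cF; rewrite -[F]setCK; apply: measurableC; apply: borel_open; rewrite openC.
Qed.

Lemma continuous_borel (S T : ptopologicalType) (f : S -> T) :
  continuous f -> measurable_fun [set: borel S] (f : borel S -> borel T).
Proof.
move=> cf; apply: (@measurability _ _ (borel S) (borel T) _ _ (@open T)) => //.
move=> _ [U oU <-]; rewrite setTI; apply: borel_open.
by move/continuousP : cf; exact.
Qed.

Section lebesgue.
Variable R : realType.
Implicit Types d : nat.

Definition vcons d (p : measurableTypeR R * borel 'rV[R]_d) :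
    borel 'rV[R]_d.+1 :=
  \row_i oapp ((p.2 : 'rV[R]_d) ord0) p.1 (unlift ord0 i).

Fixpoint lebesgue_rV d : set (borel 'rV[R]_d) -> \bar R :=
  match d with
  | 0 => \d_(0 : borel 'rV[R]_0)
  | d'.+1 => pushforward (@lebesgue_measure R \x @lebesgue_rV d')%E (@vcons d')
  end.

Lemma vcons_head d p : (vcons (d := d) p : 'rV[R]_d.+1) ord0 ord0 = p.1.
Proof. by rewrite mxE unlift_none. Qed.

Lemma vcons_tail d p i :
  (vcons (d := d) p : 'rV[R]_d.+1) ord0 (lift ord0 i) = (p.2 : 'rV[R]_d) ord0 i.
Proof. by rewrite mxE liftK. Qed.

Lemma vcons_ball d p q e :
  ball (vcons (d := d) p : 'rV[R]_d.+1) e (vcons q) <->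
  ball p.1 e q.1 /\ ball (p.2 : 'rV[R]_d) e q.2.
Proof.
split=> [[e0 b]|[b1 [e0 b2]]].
  split; first by have := b ord0 ord0; rewrite !vcons_head.
  split=> // i j; have := b ord0 (lift ord0 j).
  by rewrite !vcons_tail (ord1 i).
split=> // i j; rewrite (ord1 i).
case: (unliftP ord0 j) => [k ->|->]; last by rewrite !vcons_head.
by rewrite !vcons_tail; exact: b2.
Qed.

Lemma rat_ball_dense d (x : R) (v : 'rV[R]_d) (e : R) : 0 < e ->
  exists (q : rat) (u : 'rV[rat]_d) (r : rat),
    [/\ 0 < (ratr r : R), ratr r + ratr r < e, ball (ratr q : R) (ratr r) x &
        ball (map_mx ratr u : 'rV[R]_d) (ratr r) v].
Proof.
move=> e0.
have [r /itvP re] : exists r : rat, ratr r \in `]0, (e / 2)[.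
  by apply: rat_in_itvoo; rewrite divr_gt0.
have r0 : 0 < (ratr r : R) by rewrite re.
have near y : exists q : rat, ball (ratr q : R) (ratr r) y.
  have [q] : exists q : rat, ratr q \in `](y - ratr r), (y + ratr r)[.
    by apply: rat_in_itvoo; rewrite ltrBlDr -addrA ltrDl addr_gt0.
  rewrite in_itv/= => qy; exists q.
  by rewrite /ball/= ltr_distl.
have [q qx] := near x.
have [u uv] := choice (fun i : 'I_d => near (v ord0 i)).
exists q, (\row_i u i), r; split=> //.
  by rewrite -mulr2n -mulr_natr -ltr_pdivlMr// re.
by split=> // i j; rewrite (ord1 i) !mxE.
Qed.

Lemma measurable_vcons d : measurable_fun [set: _] (@vcons d).
Proof.
apply: (@measurability _ _ _ (borel 'rV[R]_d.+1) _ _ (@open _)) => //.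
move=> _ [U oU <-]; rewrite setTI.
pose C (c : rat * 'rV[rat]_d * rat) : set (measurableTypeR R * borel 'rV[R]_d) :=
  (ball (ratr c.1.1 : R) (ratr c.2)) `*`
  (ball (map_mx ratr c.1.2 : 'rV[R]_d) (ratr c.2)).
have mC c : measurable (C c).
  apply: measurableX; first by rewrite ball_itv; exact: measurable_itv.
  by apply: borel_open; exact: ball_open.
have -> : @vcons d @^-1` U =
   \bigcup_c (if `[< C c `<=` @vcons d @^-1` U >] then C c else set0).
  apply/seteqP; split=> [[x v] /= Uv|xv [c _]]; last first.
    by case: ifPn => // /asboolP; exact.
  have /nbhs_ballP[e /= e0 eU] : nbhs (vcons (x, v) : 'rV[R]_d.+1) U.
    by move: oU; rewrite openE; exact.
  have [q [u [r [r0 re qx uv]]]] := rat_ball_dense x v e0.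
  exists (q, u, r) => //; case: ifPn => [_|/asboolP[]]; first by split.
  move=> [y w] [/= qy uw]; apply: eU; apply/vcons_ball; split=> /=.
  - apply: (@le_ball _ _ _ (ratr r + ratr r)); first exact: ltW.
    by apply: ball_triangle qy; exact: ball_sym.
  - apply: (@le_ball _ _ _ (ratr r + ratr r)); first exact: ltW.
    by apply: ball_triangle uw; exact: ball_sym.
apply: countable_bigcupT_measurable; first exact: countableP.
by move=> c; case: ifP => _.
Qed.

Lemma lebesgue_ball_fin (x e : R) : (@lebesgue_measure R (ball x e) < +oo)%E.
Proof.
by rewrite ball_itv lebesgue_measure_itv/=; case: ifP => _; rewrite ?ltry.
Qed.

Lemma ball_fin_sigma_finite d (m : set (borel 'rV[R]_d) -> \bar R) :
  (forall e : R, (m (ball (0%R : 'rV[R]_d) e) < +oo)%E) ->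
  sigma_finite [set: _] m.
Proof.
move=> mfin; exists (fun n => ball (0 : 'rV[R]_d) n.+1%:R).
  apply/seteqP; split=> // v _.
  exists (Num.truncn `|v|) => //; rewrite -ball_normE/= sub0r normrN.
  exact: truncnS_gt.
by move=> n; split; [apply: borel_open; exact: ball_open|exact: mfin].
Qed.

Lemma lebesgue_rV_sigma_finite d :
  exists2 m : {sigma_finite_measure set (borel 'rV[R]_d) -> \bar R},
    lebesgue_rV (d := d) = m &
    forall e : R, (m (ball (0%R : 'rV[R]_d) e) < +oo)%E.
Proof.
elim: d => [|d [m lm mfin]].
  exists \d_(0 : borel 'rV[R]_0) => // e.
  by rewrite /= diracE; case: (_ \in _); rewrite ?ltry.
pose mu := pushforward (@lebesgue_measure R \x m)%E (@vcons d).
have mu_ball e : (mu (ball (0%R : 'rV[R]_d.+1) e) < +oo)%E.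
  have v0 : (vcons (0 : R, 0 : 'rV[R]_d) : 'rV[R]_d.+1) = 0.
    by apply/rowP => i; rewrite !mxE; case: unliftP => [j _|_] //=; rewrite mxE.
  rewrite /mu /pushforward.
  have -> : @vcons d @^-1` ball (0 : 'rV[R]_d.+1) e =
            ball (0 : R) e `*` ball (0 : 'rV[R]_d) e.
    rewrite -v0; apply/seteqP.
    by split=> p /=; case: (vcons_ball (0 : R, 0 : 'rV[R]_d) p e).
  rewrite product_measure1E; last 2 first.
  - by rewrite ball_itv; exact: measurable_itv.
  - by apply: borel_open; exact: ball_open.
  apply: lte_mul_pinfty; first exact: measure_ge0.
    by rewrite ge0_fin_numE; [exact: lebesgue_ball_fin|exact: measure_ge0].
  exact: mfin.
have mf := @measurable_vcons d.
have [M ME] : exists M : {measure set (borel 'rV[R]_d.+1) -> \bar R},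
    mu = M :> (set _ -> \bar R).
  have mu0 : mu set0 = 0%E by exact: measure0.
  have mu_ge0 A : (0 <= mu A)%E by exact: measure_ge0.
  have mu_sigma : semi_sigma_additive mu by exact: measure_semi_sigma_additive.
  pose M : {measure set (borel 'rV[R]_d.+1) -> \bar R} :=
    HB.pack mu (isMeasure.Build _ _ _ mu mu0 mu_ge0 mu_sigma).
  by exists (M mf).
have Mfin := ball_fin_sigma_finite mu_ball.
rewrite ME in Mfin mu_ball.
pose H2 := isSFinite.Build _ _ _ _ (sfinite_measure_sigma_finite Mfin).
pose H3 := isSigmaFinite.Build _ _ _ _ Mfin.
pose M' := HB.pack_for {sigma_finite_measure set (borel 'rV[R]_d.+1) -> \bar R}
  (Measure.sort M) H2 H3.
exists M' => //=; first by rewrite lm -[RHS]ME.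
Qed.

Let lebesgue_rV0 d : lebesgue_rV (d := d) set0 = 0%E.
Proof. by have [m -> _] := lebesgue_rV_sigma_finite d; exact: measure0. Qed.

Let lebesgue_rV_ge0 d A : (0 <= lebesgue_rV (d := d) A)%E.
Proof. by have [m -> _] := lebesgue_rV_sigma_finite d; exact: measure_ge0. Qed.

Let lebesgue_rV_sigma_additive d : semi_sigma_additive (lebesgue_rV (d := d)).
Proof.
by have [m -> _] := lebesgue_rV_sigma_finite d; exact: measure_semi_sigma_additive.
Qed.

HB.instance Definition _ d := isMeasure.Build _ _ _ (lebesgue_rV (d := d))
  (@lebesgue_rV0 d) (@lebesgue_rV_ge0 d) (@lebesgue_rV_sigma_additive d).

Let lebesgue_rV_sigma_finiteT d : sigma_finite [set: _] (lebesgue_rV (d := d)).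
Proof. by have [m -> _] := lebesgue_rV_sigma_finite d; exact: sigma_finiteT. Qed.

HB.instance Definition _ d := Measure_isSigmaFinite.Build _ _ _
  (lebesgue_rV (d := d)) (@lebesgue_rV_sigma_finiteT d).

Lemma lebesgue_rV_ball_fin d (e : R) :
  (lebesgue_rV (ball (0%R : 'rV[R]_d) e) < +oo)%E.
Proof. by have [m -> ] := lebesgue_rV_sigma_finite d; exact. Qed.

Lemma lebesgue_rV_box d (a b : 'rV[R]_d) :
  (forall i, a ord0 i <= b ord0 i) ->
  lebesgue_rV [set v : 'rV[R]_d | forall i, v ord0 i \in `[a ord0 i, b ord0 i]] =
  (\prod_i (b ord0 i - a ord0 i))%:E.
Proof.
elim: d a b => [|d ih] a b ab.
  by rewrite big_ord0 /= diracE mem_set//; case.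
pose a' := \row_i a ord0 (lift ord0 i); pose b' := \row_i b ord0 (lift ord0 i).
have ab' i : a' ord0 i <= b' ord0 i by rewrite !mxE.
rewrite big_ord_recl EFinM /=.
have -> : \prod_(i < d) (b ord0 (lift ord0 i) - a ord0 (lift ord0 i)) =
          \prod_i (b' ord0 i - a' ord0 i).
  by apply: eq_bigr => i _; rewrite !mxE.
rewrite -(ih _ _ ab') /pushforward.
set B := [set v : 'rV[R]_d | _].
have mB : measurable (B : set (borel 'rV[R]_d)).
  rewrite [B](_ : _ =
    \bigcap_(i in [set: 'I_d]) (fun v : 'rV[R]_d => v ord0 i) @^-1` `[a' ord0 i, b' ord0 i]).
    apply: fin_bigcap_measurable => // i _.
    apply: borel_closed; apply: closed_comp; last exact: itv_closed.
    by move=> v _; exact: coord_continuous.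
  by apply/seteqP; split=> v /= vB i => [_|]; exact: vB.
rewrite [X in _ X = _](_ : _ = `[a ord0 ord0, b ord0 ord0]%classic `*` B).
  rewrite product_measure1E//; congr (_ * _)%E.
  apply: etrans (lebesgue_measure_itv _) _ => /=.
  rewrite lte_fin; case: ltgtP (ab ord0) => // -> _.
  by rewrite subrr.
apply/seteqP; split=> p /=.
  move=> pab; split; first by have := pab ord0; rewrite vcons_head.
  by move=> i; have := pab (lift ord0 i); rewrite vcons_tail !mxE.
move=> [p1 p2] i; case: (unliftP ord0 i) => [j ->|->]; last by rewrite vcons_head.
by rewrite vcons_tail; have := p2 j; rewrite !mxE.
Qed.

End lebesgue.

Section transportation.
Variables (R : realType) (d : nat).
Local Notation E := 'rV[R]_d.
Implicit Types (nu : {measure set (borel E) -> \bar R}) (z : E).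

(* `|v| is the sup norm on 'rV[R]_d (it induces the same topology) *)
Definition enorm (v : E) : R := Num.sqrt (\sum_i v ord0 i ^+ 2).

Definition locally_finite (T : ptopologicalType) (mu : set (borel T) -> \bar R) :=
  forall x : T, exists2 U : set T, open_nbhs x U & (mu U < +oo)%E.

Definition msupport (T : ptopologicalType) (mu : set (borel T) -> \bar R) : set T :=
  [set x | forall U : set T, open_nbhs x U -> (0 < mu U)%E].

(* translate nu z A = nu (A - z) *)
Definition translate nu z : set (borel E) -> \bar R :=
  pushforward nu (fun x : borel E => (x : E) + z : borel E).

Let measurable_translation z :
  measurable_fun [set: borel E] (fun x : borel E => (x : E) + z : borel E).
Proof.
suff cz : continuous (fun x : E => x + z) by exact: continuous_borel cz.
move=> x; apply: (@cvgD R E E (nbhs x) _ id (fun=> z) x z).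
  exact: cvg_id.
exact: cvg_cst.
Qed.

Let translate0 nu z : translate nu z set0 = 0%E.
Proof. by have := measurable_translation z => ?; exact: measure0. Qed.

Let translate_ge0 nu z A : (0 <= translate nu z A)%E.
Proof. by have := measurable_translation z => ?; exact: measure_ge0. Qed.

Let translate_sigma_additive nu z : semi_sigma_additive (translate nu z).
Proof.
by have := measurable_translation z => ?; exact: measure_semi_sigma_additive.
Qed.

HB.instance Definition _ nu z := isMeasure.Build _ _ _ (translate nu z)
  (@translate0 nu z) (@translate_ge0 nu z) (@translate_sigma_additive nu z).

Definition compactly_supported (phi : E -> R) :=
  compact (closure [set x | phi x != 0]).

Definition transportation nu1 nu2
    (gamma : {measure set (borel (E * E)) -> \bar R}) :=
  forall phi : E -> R, continuous phi -> compactly_supported phi ->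
    (\int[gamma]_p (phi p.1)%:E = \int[nu1]_x (phi x)%:E)%E /\
    (\int[gamma]_p (phi p.2)%:E = \int[nu2]_x (phi x)%:E)%E.

(* the supremum is taken in [0, +oo], hence is 0 when the support is empty *)
Definition displacement (gamma : {measure set (borel (E * E)) -> \bar R}) :
    \bar R :=
  maxe 0%E (ereal_sup
    [set (enorm (p.1 - p.2))%:E | p in closure (msupport gamma)]).

Definition Tra nu1 nu2 : \bar R :=
  ereal_inf [set displacement gamma | gamma in transportation nu1 nu2].

Definition uniformly_spread nu :=
  exists beta : {posnum R},
    (Tra nu (mscale (beta%:num%:nng)%R (@lebesgue_rV R d)) < +oo)%E.

End transportation.

(* Main.v *)
(** The measures are discretised on the unit cubes [cube (lat k)], [k] an integer
vector. A transport of bounded displacement induces masses [P k l] moved from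
cube to cube with [|k - l|] bounded (a [plan]), and conversely a plan is realised
by spreading each [P k l] as a product measure over the two cubes, at the cost of a
bounded extra displacement.

If [nu] is carried to [beta * Lebesgue], the cube masses of [nu] and of each
translate of [nu] have plans of a common radius to the constant [beta]; gluing the
first with the transpose of the second carries [nu] to its translate.

Conversely, call [b] shift-reachable if plans of one fixed radius carry the cube
masses of [nu] to all shifts of [b]. This property is stable under shifts, convex
combinations and pointwise limits, so averaging along each coordinate direction in
turn and passing to a limit along an ultrafilter yields a shift-reachable constant,
which is positive because [nu] is not zero. *)

From HB Require Import structures.
Require Import Defs.
From mathcomp Require Import all_boot all_order all_algebra.
From mathcomp Require Import finmap interval_inference.
From mathcomp Require Import all_classical all_reals all_analysis.
From mathcomp Require Import measurable_realfun.
From mathcomp Require Import lra zify.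
Set Implicit Arguments.
Unset Strict Implicit.
Unset Printing Implicit Defensive.
Import Order.TTheory GRing.Theory Num.Theory.
Import numFieldNormedType.Exports.
Local Open Scope classical_set_scope.
Local Open Scope ring_scope.

(** * Plans on the integer lattice *)

Lemma absz_shift (x : int) (n r : nat) : (n < r.*2.+1)%N ->
  (`|(x + (n%:Z - r%:Z) - x)%R| <= r)%N.
Proof. by lia. Qed.

Section lattice.
Variable d : nat.
Local Notation Z := 'rV[int]_d.
Implicit Types (k l m z : Z) (r : nat).

Definition near_lattice r k l := [forall i, (`|(l ord0 i - k ord0 i)%R| <= r)%N].

(** A duplicate-free list of the sup-norm ball: [r.*2.+1] values per coordinate, recentred by
    subtracting [r]. All lattice sums thereby stay finite. *)
Definition zball r k : seq Z :=
  [seq k + \row_i ((j i : nat)%:Z - r%:Z) | j : {ffun 'I_d -> 'I_(r.*2.+1)}].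

Lemma mem_zball r k l : (l \in zball r k) = near_lattice r k l.
Proof.
apply/fintype.imageP/forallP => [[j _ ->] i|H].
  rewrite !mxE; have := ltn_ord (j i); exact: absz_shift.
exists [ffun i => inord (absz (l ord0 i - k ord0 i + r%:Z)%R)] => //.
apply/rowP => i; rewrite !mxE ffunE; have := H i.
by move: (l ord0 i) (k ord0 i) => x y xy; rewrite inordK; lia.
Qed.

Lemma zball_uniq r k : uniq (zball r k).
Proof.
rewrite /zball map_inj_uniq ?enum_uniq// => j j' /addrI/rowP jj'.
apply/ffunP => i; apply/val_inj; have := jj' i; rewrite !mxE /=.
by move/addIr => [].
Qed.

Lemma near_lattice_sym r k l : near_lattice r k l = near_lattice r l k.
Proof. by apply: eq_forallb => i; rewrite distnC. Qed.

Lemma near_latticeD r k l z : near_lattice r (k + z) (l + z) = near_lattice r k l.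
Proof. by apply: eq_forallb => i; rewrite !mxE opprD addrACA subrr addr0. Qed.

Lemma near_lattice_trans r s k l m :
  near_lattice r k l -> near_lattice s l m -> near_lattice (r + s) k m.
Proof.
move=> /forallP h1 /forallP h2; apply/forallP => i.
move: (h1 i) (h2 i); move: (k _ _) (l _ _) (m _ _) => x y w; lia.
Qed.

(** Both sums reduce to the one over the common elements, the other terms being zero. This allows a
    ball of summation to be exchanged for another one that contains the support. *)
Lemma eq_big_supp (V : nmodType) (s t : seq Z) (f : Z -> V) :
  uniq s -> uniq t ->
  (forall k, f k != 0 -> (k \in s) && (k \in t)) ->
  \sum_(k <- s) f k = \sum_(k <- t) f k.
Proof.
move=> us ut fst.
have red (u v : seq Z) : (forall k, f k != 0 -> (k \in v)) ->
    \sum_(k <- u) f k = \sum_(k <- [seq k <- u | k \in v]) f k.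
  move=> fv; rewrite big_filter [LHS](bigID (mem v))/= [X in _ + X]big1 ?addr0//.
  by move=> k; apply: contraNeq; exact: fv.
rewrite (red s t) ?(red t s); [|by move=> k /fst/andP[]..].
apply: perm_big; apply: uniq_perm; rewrite ?filter_uniq// => k.
by rewrite !mem_filter andbC.
Qed.

Lemma big_zball_shift (V : nmodType) r k z (f : Z -> V) :
  \sum_(l <- zball r (k + z)) f l = \sum_(l <- zball r k) f (l + z).
Proof.
rewrite -(big_map (fun l => l + z) xpredT f); apply: perm_big.
apply: uniq_perm; first exact: zball_uniq.
  by rewrite map_inj_uniq ?zball_uniq//; exact: addIr.
move=> l; rewrite mem_zball; apply/idP/mapP => [kl|[m + ->]].
  exists (l - z); last by rewrite subrK.
  by rewrite mem_zball -(near_latticeD _ _ _ z) subrK.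
by rewrite mem_zball near_latticeD.
Qed.

Variable R : realType.
Implicit Types (a b c : Z -> R) (P : Z -> Z -> R).

(** A transport matrix of range [r]. Since [P k l] vanishes off the range, the sums over balls are
    the full row and column sums. *)
Definition plan r a b P := [/\ forall k l, 0 <= P k l,
  forall k l, P k l != 0 -> near_lattice r k l,
  forall k, \sum_(l <- zball r k) P k l = a k &
  forall l, \sum_(k <- zball r l) P k l = b l].

Lemma plan_sym r a b P : plan r a b P -> plan r b a (fun k l => P l k).
Proof.
by case=> P0 Pn Pa Pb; split=> // k l /Pn; rewrite near_lattice_sym.
Qed.

Lemma plan_sum r a b P k (t : seq Z) : plan r a b P ->
  uniq t -> (forall l, near_lattice r k l -> l \in t) ->
  \sum_(l <- t) P k l = a k.
Proof.
case=> P0 Pn Pa Pb ut rt; rewrite -Pa; apply: eq_big_supp => //.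
  exact: zball_uniq.
by move=> l /Pn kl; rewrite mem_zball kl rt.
Qed.


Lemma plan_le r a b P k l : plan r a b P -> P k l <= a k.
Proof.
case=> P0 Pn Pa Pb; have [->|Pkl] := eqVneq (P k l) 0.
  by rewrite -Pa; exact: sumr_ge0.
rewrite -Pa (bigD1_seq l) ?zball_uniq ?mem_zball ?Pn//=.
by rewrite lerDl sumr_ge0.
Qed.

(** The mass at [k] lands inside the ball around [k], and no site [l] receives more than [b l]. *)
Lemma plan_mass_le r a b P k : plan r a b P -> a k <= \sum_(l <- zball r k) b l.
Proof.
move=> PP; have [_ _ <- _] := PP.
by apply: ler_sum => l _; exact: plan_le (plan_sym PP).
Qed.

(** Conditionally independent gluing over the intermediate site: [P k l] is distributed among the
    [m] in proportion to [Q m l], whose total over [m] is [beta]. *)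
Lemma plan_glue r s a c (beta : R) P Q : 0 < beta ->
  plan r a (fun=> beta) P -> plan s c (fun=> beta) Q ->
  exists G, plan (r + s) a c G.
Proof.
move=> b0 PP QQ; have [P0 Pn Pa Pb] := PP; have [Q0 Qn Qc Qb] := QQ.
exists (fun k m => beta^-1 * \sum_(l <- zball r k) P k l * Q m l).
split.
- move=> k m; apply: mulr_ge0; first by rewrite invr_ge0 ltW.
  by apply: sumr_ge0 => l _; exact: mulr_ge0.
- move=> k m; apply: contraNT => nkm; rewrite big1_seq ?mulr0//= => l.
  rewrite mem_zball => kl; have [->|/Qn ml] := eqVneq (Q m l) 0; rewrite ?mulr0//.
  by move: nkm; rewrite (near_lattice_trans kl)// near_lattice_sym.
- move=> k; rewrite -mulr_sumr exchange_big/=.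
  transitivity (beta^-1 * \sum_(l <- zball r k) P k l * beta).
    congr (_ * _); apply: eq_big_seq => l; rewrite mem_zball => kl.
    rewrite -mulr_sumr (plan_sum (plan_sym QQ)) ?zball_uniq// => m lm.
    by rewrite mem_zball (near_lattice_trans kl).
  by rewrite -mulr_suml Pa mulrC mulfK// gt_eqF.
- move=> m.
  (* For fixed [m] the sum over [k] has to become the inner one, so the range of [l] is recentred
     from [k] to [m]; the product lives on the intersection of the two balls. *)
  have E k : \sum_(l <- zball r k) P k l * Q m l =
             \sum_(l <- zball s m) P k l * Q m l.
    apply: eq_big_supp; rewrite ?zball_uniq// => l.
    by rewrite mulf_eq0 negb_or => /andP[/Pn ? /Qn ?]; rewrite !mem_zball; apply/andP.
  under eq_bigr => k _ do rewrite E.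
  rewrite -mulr_sumr exchange_big/=.
  transitivity (beta^-1 * \sum_(l <- zball s m) beta * Q m l).
    congr (_ * _); apply: eq_big_seq => l; rewrite mem_zball => ml.
    rewrite -mulr_suml (plan_sum (plan_sym PP)) ?zball_uniq// => k lk.
    by rewrite mem_zball addnC (near_lattice_trans ml).
  by rewrite -mulr_sumr Qc mulKf// gt_eqF.
Qed.

(** Plans of radius [r] out of a fixed [a] are stable under averaging: the marginal conditions are
    linear and the range is common. *)
Lemma plan_avg n r a (b : nat -> Z -> R) (P : nat -> Z -> Z -> R) :
  (forall t, plan r a (b t) (P t)) ->
  plan r a (fun l => n.+1%:R^-1 * \sum_(t < n.+1) b t l)
    (fun k l => n.+1%:R^-1 * \sum_(t < n.+1) P t k l).
Proof.
move=> PP; split.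
- move=> k l; apply: mulr_ge0; first by rewrite invr_ge0.
  by apply: sumr_ge0 => t _; have [] := PP t.
- move=> k l; apply: contraNT => nkl; rewrite big1 ?mulr0// => t _.
  by apply/eqP; move: nkl; apply: contraNT; have [_ + _ _] := PP t; exact.
- move=> k; rewrite -mulr_sumr exchange_big/=.
  under eq_bigr => t _ do have [_ _ -> _] := PP t.
  by rewrite sumr_const card_ord -[a k *+ _]mulr_natl mulKf.
- move=> l; rewrite -mulr_sumr exchange_big/=; congr (_ * _).
  by apply: eq_bigr => t _; have [_ _ _ ->] := PP t.
Qed.

(** * Limits of plans along an ultrafilter *)

Section ultralimit.
Variables (U : set_system nat) (UU : UltraFilter U).

(** By compactness of the segment the image ultrafilter has a cluster point, and a cluster point of
    an ultrafilter is a limit. One ultrafilter serves all lattice sites at once, in place of a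
    diagonal extraction. *)
Lemma ultra_bounded_cvg (u : nat -> R) (M : R) :
  (forall n, 0 <= u n <= M) -> cvg (u @ U).
Proof.
move=> uM; have /(_ (u @ U)) [] := @segment_compact R 0 M.
  by apply: nearW => n /=; rewrite in_itv/=.
move=> l [_ ul]; apply/cvg_ex; exists l => A Al.
have [//|UA] := in_ultra_setVsetC (u @^-1` A) UU.
by have [x [/= + Ax]] := ul (~` A) A UA Al.
Qed.

Lemma sum_lim (I : Type) (s : seq I) (f : I -> nat -> R) :
  (forall i, cvg (f i @ U)) ->
  \sum_(i <- s) lim (f i @ U) = lim ((\sum_(i <- s) f i n) @[n --> U]).
Proof.
move=> cf; apply/esym/cvg_lim => //.
apply: cvg_big => [|l _]; [exact: add_continuous|exact: cf].
Qed.

(** Each entry is bounded by [a k], hence converges along [U]. The marginals are finite sums over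
    balls that do not depend on [n], so no mass escapes in the limit. *)
Lemma plan_lim r a (b : nat -> Z -> R) (P : nat -> Z -> Z -> R) :
  (forall n, plan r a (b n) (P n)) ->
  exists Q, plan r a (fun l => lim (b n l @[n --> U])) Q.
Proof.
move=> PP.
have cP k l : cvg (P n k l @[n --> U]).
  apply: (@ultra_bounded_cvg _ (a k)) => n; rewrite (plan_le _ _ (PP n)) andbT.
  by have [] := PP n.
exists (fun k l => lim (P n k l @[n --> U])); split.
- by move=> k l; apply: limr_ge => //; near=> n; have [] := PP n.
- move=> k l; apply: contraNT => nkl; rewrite (_ : (fun n => _) = fun=> 0) ?lim_cst//.
  apply/funext => n; apply/eqP; move: nkl; apply: contraNT.
  by have [_ + _ _] := PP n; exact.
- move=> k; rewrite sum_lim// (_ : (fun n => _) = fun=> a k) ?lim_cst//.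
  by apply/funext => n; have [_ _ -> _] := PP n.
- move=> l; rewrite sum_lim// (_ : (fun n => _) = fun n => b n l)//.
  by apply/funext => n; have [_ _ _ ->] := PP n.
Unshelve. all: by end_near.
Qed.

End ultralimit.

(* Closed under shifts, averages and pointwise limits, unlike the set of [b]
   that merely receive a plan of radius [r] from [a]. *)
Definition shift_reachable r a b := forall z, exists P, plan r a (fun l => b (l + z)) P.

(** A plan from [a] to its shift by [- k] bounds [a k] by the mass [A] of the ball around the
    origin, uniformly in [k]. Then [b l] collects mass from the ball around [l] only, hence at most
    [A] from each of its sites. *)
Lemma shift_reachable_bound r a b : shift_reachable r a a -> shift_reachable r a b ->
  exists M, forall l, 0 <= b l <= M.
Proof.
move=> aa ab; pose A := \sum_(l <- zball r 0) a l.
have aA k : a k <= A.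
  have [P /plan_mass_le] := aa (- k) => /(_ k); rewrite -{2}[k]add0r big_zball_shift.
  by under eq_bigr do rewrite addrK.
exists (\sum_(l <- zball r 0) A) => l; have [P PP] := ab 0.
have [P0 _ _ Pb] := PP; have {1 2}<- : b (l + 0) = b l by rewrite addr0.
rewrite -Pb sumr_ge0//= -[l]add0r big_zball_shift.
by apply: ler_sum => k _; apply: le_trans (aA (k + l)); exact: plan_le PP.
Qed.

(** * Cesaro averages and the reduction to a constant *)

Definition cesaro b (e : Z) l (n : nat) : R :=
  n.+1%:R^-1 * \sum_(t < n.+1) b (l + e *+ t).

(** The difference telescopes to two boundary values of [b], both in [[0, M]], divided by [n.+1]. *)
Lemma cesaro_shift b e l M : (forall l, 0 <= b l <= M) ->
  cesaro b e (l + e) n - cesaro b e l n @[n --> \oo] --> (0 : R).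
Proof.
move=> bM.
have E n : cesaro b e (l + e) n - cesaro b e l n =
           n.+1%:R^-1 * (b (l + e *+ n.+1) - b l).
  rewrite /cesaro -mulrBr; congr (_ * _).
  under eq_bigr do rewrite -addrA -mulrS.
  rewrite big_ord_recr [X in _ - X]big_ord_recl/= mulr0n addr0.
  under [X in _ - (_ + X)]eq_bigr do rewrite /bump/= add1n.
  by rewrite opprD [- _ - _]addrC addrACA subrr add0r.
under eq_cvg do rewrite E.
apply/cvgr0Pnorm_le => eps e0.
have hM : harmonic n * M @[n --> \oo] --> (0 : R).
  by rewrite -[0](mul0r M); apply: cvgMl; exact: cvg_harmonic.
near=> n; apply: (@le_trans _ _ (harmonic n * M)).
  rewrite normrM ger0_norm ?invr_ge0// ler_wpM2l ?invr_ge0//.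
  have := bM l; have := bM (l + e *+ n.+1); move=> /andP[? ?] /andP[? ?].
  by rewrite ler_norml; apply/andP; split; lra.
near: n; move/cvgr0Pnorm_le : hM => /(_ _ e0); apply: filterS => n.
by apply: le_trans; exact: ler_norm.
Unshelve. all: by end_near. Qed.

(** The limit of the Cesaro averages along [e], taken along an ultrafilter finer than the filter at
    infinity. The last clause keeps the periods already gained, so that the directions can be
    treated one after another. *)
Lemma shift_reachable_average r a b (e : Z) :
  shift_reachable r a a -> shift_reachable r a b ->
  exists b', [/\ shift_reachable r a b', forall l, b' (l + e) = b' l &
    forall v, (forall l, b (l + v) = b l) -> forall l, b' (l + v) = b' l].
Proof.
move=> aa ab; have [M bM] := shift_reachable_bound aa ab.
have [U [UU Uoo]] := ultraFilterLemma (@eventually_filter).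
have cU l : cvg (cesaro b e l @ U).
  apply: (@ultra_bounded_cvg _ _ _ M) => n; apply/andP; split.
    by rewrite mulr_ge0 ?invr_ge0// sumr_ge0// => t _; have /andP[] := bM (l + e *+ t).
  rewrite /cesaro mulrC ler_pdivrMr// mulr_natr.
  apply: (@le_trans _ _ (\sum_(t < n.+1) M)); last by rewrite sumr_const card_ord.
  by apply: ler_sum => t _; have /andP[] := bM (l + e *+ t).
exists (fun l => lim (cesaro b e l @ U)); split.
(* The shift by [z] of an average is the average of the shifts by [z + e *+ t], each of which has
   its own plan out of [a]. *)
- move=> z; have [P PP] := choice ab.
  have := plan_lim UU (fun n => plan_avg n (fun t => PP (z + e *+ t))).
  move=> [Q QQ]; exists Q.
  rewrite (_ : (fun l => _) = (fun l => lim ((n.+1%:R^-1 *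
    \sum_(t < n.+1) b (l + (z + e *+ t))) @[n --> U])))//.
  apply/funext => l; rewrite (_ : cesaro _ _ _ = fun n => n.+1%:R^-1 *
    \sum_(t < n.+1) b (l + (z + e *+ t)))//.
  by apply/funext => n; rewrite /cesaro; under eq_bigr do rewrite -addrA.
(* The difference tends to zero at infinity, hence along the finer [U]. *)
- move=> l; apply/eqP; rewrite -subr_eq0; apply/eqP.
  rewrite -limB//; apply/cvg_lim => //.
  by move=> A /(@cesaro_shift b e l M bM)/Uoo.
- move=> v bv l; rewrite (_ : cesaro b e (l + v) = cesaro b e l)//.
  apply/funext => n; rewrite /cesaro; congr (_ * _).
  by apply: eq_bigr => t _; rewrite addrAC bv.
Qed.

Lemma shift_reachable_const r a k0 : (forall k, 0 <= a k) -> 0 < a k0 ->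
  shift_reachable r a a ->
  exists beta P, 0 < beta /\ plan r a (fun=> beta) P.
Proof.
move=> a0 ak0 aa.
(* Induction on the list of coordinate directions, starting from [a] itself and averaging along one
   more direction each time. *)
have [b [ab bi]] : exists b, shift_reachable r a b /\
    forall i, i \in enum 'I_d -> forall l, b (l + delta_mx ord0 i) = b l.
  elim: (enum 'I_d) => [|i s [b [ab bs]]]; first by exists a.
  have [b' [ab' bi bv]] := shift_reachable_average (delta_mx ord0 i) aa ab.
  exists b'; split=> // j; rewrite inE => /predU1P[->//|js].
  by apply: bv; exact: bs.
have bn (v : Z) : (forall l, b (l + v) = b l) -> forall n l, b (l + v *+ n) = b l.
  by move=> bv; elim=> [|n ih] l; rewrite ?addr0// mulrSr addrA bv.
have bz (v : Z) : (forall l, b (l + v) = b l) -> forall (n : int) l, b (l + v *~ n) = b l.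
  move=> bv [n|n] l; first exact: bn.
  by rewrite NegzE mulrNz -[in RHS](subrK (v *+ n.+1) l) bn.
have b_cst l : b l = b 0.
  (* With a free base point [m], the coordinates of [l] can be removed one at a time. *)
  suff H (s : seq 'I_d) m :
      b (m + \sum_(i <- s) l ord0 i *: delta_mx ord0 i) = b m.
    by rewrite [X in b X]row_sum_delta -[X in b X]add0r H.
  elim: s m => [|i s IH] m; first by rewrite big_nil addr0.
  rewrite big_cons addrA IH -[l ord0 i]intz scaler_int bz// => k.
  by apply: bi; rewrite mem_enum.
exists (b 0); have [P PP] := ab 0; exists P.
have EP : (fun l => b (l + 0)) = fun=> b 0 by apply/funext => l; exact: b_cst.
rewrite EP in PP; split=> //.
(* A constant [b 0 <= 0] could not receive the positive mass [a k0]. *)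
rewrite ltNge; apply/negP => b0; have := plan_mass_le k0 PP.
rewrite leNgt => /negP; apply; apply: le_lt_trans ak0.
by apply: sumr_le0.
Qed.

End lattice.

(** * From transportation measures to plans *)

(** Any countable index type is allowed, so as to cover both unit cubes indexed by integer vectors
    and boxes indexed by rational data. *)
Lemma countable_null_cover (disp : measure_display) (T : measurableType disp)
    (R : realType) (mu : {measure set T -> \bar R}) (F : set T) (I : countType)
    (N : I -> set T) :
  measurable F -> (forall i, measurable (N i)) -> (forall i, mu (N i) = 0%E) ->
  F `<=` \bigcup_i N i -> mu F = 0%E.
Proof.
move=> mF mN N0 FN; apply: measure_negligible => //.
apply: (@negligibleS _ _ _ mu (\bigcup_(n : nat) (oapp N set0 (choice.unpickle n)))).
  by move=> x /FN[i _ xi]; exists (choice.pickle i) => //; rewrite choice.pickleK.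
apply: negligible_bigcup => n.
case: (choice.unpickle n) => [i|] /=; last exact: negligible_set0.
by exists (N i); split.
Qed.

(** * Unit cubes, rational boxes and null sets *)

Section borel_rV.
Variables (R : realType) (d : nat).
Local Notation E := 'rV[R]_d.
Implicit Types (u x : E) (nu : {measure set (borel E) -> \bar R}).

(** Half-open, so that the integer translates of a cube partition the space. *)
Definition cube u : set E := [set x | forall i, u ord0 i <= x ord0 i < u ord0 i + 1].

Lemma measurable_cube u : measurable (cube u : set (borel E)).
Proof.
rewrite (_ : cube u = \bigcap_(i in [set: 'I_d])
    ([set x : E | u ord0 i <= x ord0 i] `&` [set x : E | x ord0 i < u ord0 i + 1])).
  apply: fin_bigcap_measurable => // i _; apply: measurableI.
    apply: borel_closed; apply: preimage_closed (@closed_ge _ (u ord0 i)).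
    by move=> v _; exact: coord_continuous.
  apply: borel_open; apply: open_comp (@open_lt _ (u ord0 i + 1)).
  by move=> v _; exact: coord_continuous.
apply/seteqP; split=> x /= xu i; first by move=> _; apply/andP; exact: xu.
by have /andP := xu i I.
Qed.

Lemma norm_rV_leP x (M : R) : 0 <= M -> `|x| <= M <-> forall i, `|x ord0 i| <= M.
Proof.
move=> M0; rewrite [Num.norm x]mx_normrE; split=> [/bigmax_leP[_ h] i|h].
  exact: (h (ord0, i) isT).
by apply/bigmax_leP; split=> // -[i j] _ /=; rewrite (ord1 i).
Qed.

Lemma cube_norm u x : cube u x -> `|x| <= `|u| + 1.
Proof.
move=> xu; apply/norm_rV_leP; first exact: addr_ge0.
move=> j; have /norm_rV_leP/(_ j) := lexx `|u|; rewrite normr_ge0 => /(_ isT).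
have /andP[] := xu j; rewrite !ler_norml => ? ? /andP[? ?].
by apply/andP; split; lra.
Qed.

Lemma locally_finite_compact nu (K : set E) : locally_finite nu ->
  compact K -> (nu K < +oo)%E.
Proof.
move=> nu_lf cK.
have cKm : measurable (K : set (borel E)).
  by apply: borel_closed; apply: compact_closed => //; exact: norm_hausdorff.
have /choice[f fP] x : exists U : set E, open_nbhs x U /\ (nu U < +oo)%E.
  by have [U ? ?] := nu_lf x; exists U.
move: cK; rewrite compact_cover => /(_ E K f) [||D _ KD].
- by move=> x _; have [[]] := fP x.
- by move=> x Kx; exists x => //; have [[_]] := fP x.
have : (nu K <= \sum_(x \in [set` D]) nu (f x))%E.
  by apply: content_sub_fsum => // x _; apply: borel_open; have [[]] := fP x.
move/le_lt_trans; apply.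
rewrite -fsbig_seq//=; apply: lte_sum_pinfty => x _.
by have [] := fP x.
Qed.

Lemma locally_finite_bounded nu (A : set E) (M : R) : locally_finite nu ->
  measurable (A : set (borel E)) -> (forall x, A x -> `|x| <= M) -> (nu A < +oo)%E.
Proof.
move=> nu_lf mA AM.
have cK : compact [set x : E | `|x| <= M].
  apply: bounded_closed_compact.
    by exists M; split; [exact: num_real|move=> y My x /= /le_trans; apply; exact: ltW].
  apply: preimage_closed (@closed_le _ M).
  by move=> x _; exact: norm_continuous.
apply: le_lt_trans (locally_finite_compact nu_lf cK).
apply: le_measure => //; rewrite inE//.
by apply: borel_closed; apply: compact_closed => //; exact: norm_hausdorff.
Qed.

Lemma measurable_borel_fst :
  measurable_fun [set: borel (E * E)] (fun p => p.1 : borel E).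
Proof. by apply: (@continuous_borel (E * E)%type E fst) => p; exact: cvg_fst. Qed.

Lemma measurable_borel_snd :
  measurable_fun [set: borel (E * E)] (fun p => p.2 : borel E).
Proof. by apply: (@continuous_borel (E * E)%type E snd) => p; exact: cvg_snd. Qed.

Lemma measurable_borelX (A B : set (borel E)) : measurable A -> measurable B ->
  measurable (A `*` B : set (borel (E * E))).
Proof.
move=> mA mB; rewrite (_ : _ `*` _ = (setT `&` (fun p => p.1) @^-1` A) `&`
  (setT `&` (fun p => p.2) @^-1` B)); last by rewrite !setTI.
by apply: measurableI; [exact: measurable_borel_fst|exact: measurable_borel_snd].
Qed.

(** A countable base of the product topology. *)
Definition rat_box (c : ('rV[rat]_d * rat) * ('rV[rat]_d * rat)) : set (E * E) :=
  ball (map_mx ratr c.1.1 : E) (ratr c.1.2) `*`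
  ball (map_mx ratr c.2.1 : E) (ratr c.2.2).

Lemma open_rat_box (U : set (E * E)) (p : E * E) : open U -> U p ->
  exists c, rat_box c p /\ rat_box c `<=` U.
Proof.
move=> oU Up.
have /nbhs_ballP[e /= e0 eU] : nbhs p U by move: oU; rewrite openE; exact.
have [_ [u [r [r0 re _ ux]]]] := rat_ball_dense 0 p.1 e0.
have [_ [v [s [s0 se _ vy]]]] := rat_ball_dense 0 p.2 e0.
exists ((u, r), (v, s)); split; first by split.
move=> [y w] [/= uy vw]; apply: eU; split=> /=.
- apply: (@le_ball _ _ _ (ratr r + ratr r)); first exact: ltW.
  by apply: ball_triangle uy; exact: ball_sym.
- apply: (@le_ball _ _ _ (ratr s + ratr s)); first exact: ltW.
  by apply: ball_triangle vw; exact: ball_sym.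
Qed.

Lemma open_rat_boxE (U : set (E * E)) : open U ->
  U = \bigcup_c (if `[< rat_box c `<=` U >] then rat_box c else set0).
Proof.
move=> oU; apply/seteqP; split=> [p Up|p [c _]]; last first.
  by case: ifPn => // /asboolP; exact.
have [c [cp cU]] := open_rat_box oU Up.
by exists c => //; case: ifPn => // /asboolP[].
Qed.

(** By second countability an open set of the product is a countable union of rational boxes, so the
    Borel sets of [E * E] belong to the product sigma-algebra. *)
Lemma measurable_prod_borel :
  measurable_fun [set: borel E * borel E] (fun p => p : borel (E * E)).
Proof.
apply: (@measurability _ _ _ (borel (E * E)) _ _ (@open _)) => //.
move=> _ [U oU <-]; rewrite setTI preimage_id (open_rat_boxE oU).
apply: countable_bigcupT_measurable; first exact: countableP.
move=> c; case: ifP => _ //.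
by apply: measurableX; apply: borel_open; exact: ball_open.
Qed.

(** A Lindelof argument: each point off the support lies in a null rational box, and there are
    countably many of these. *)
Lemma msupport_null (gamma : {measure set (borel (E * E)) -> \bar R}) (F : set (E * E)) :
  measurable (F : set (borel (E * E))) -> F `<=` ~` msupport gamma ->
  gamma F = 0%E.
Proof.
move=> mF Fsupp.
have mbox c : measurable (rat_box c : set (borel (E * E))).
  apply: measurable_borelX; apply: borel_open; exact: ball_open.
pose N c := if gamma (rat_box c) == 0%E then rat_box c else set0.
have mN c : measurable (N c : set (borel (E * E))) by rewrite /N; case: ifP.
have N0 c : gamma (N c) = 0%E.
  by rewrite /N; case: ifPn => [/eqP//|_]; exact: measure0.
apply: (@countable_null_cover _ _ _ gamma F _ N) => //.
move=> p /Fsupp /= /existsNP[U /not_implyP[[oU Up] /negP]].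
rewrite lt0e measure_ge0 andbT negbK => /eqP U0.
have [c [cp cU]] := open_rat_box oU Up.
exists c => //; rewrite /N ifT//.
rewrite -measure_le0 -U0; apply: le_measure; rewrite ?inE//.
exact: borel_open.
Qed.

End borel_rV.

(** * Cube masses from continuous test functions *)

Section marginals.
Variables (R : realType) (d : nat).
Local Notation E := 'rV[R]_d.
Implicit Types (u x : E) (t : R) (mu nu : {measure set (borel E) -> \bar R}).

Definition clamp t : R := Num.max 0 (Num.min 1 t).

(** A continuous approximation of the indicator of the half-open unit interval. The left ramp lies
    before 0 and the right ramp before 1, so the pointwise limit is 1 at 0 and 0 at 1. *)
Definition trapezoid (n : nat) t : R :=
  clamp (Num.min (1 + n.+1%:R * t) (n.+1%:R * (1 - t))).

(** A compactly supported bound common to all [trapezoid n]: it equals 1 for [|t| <= 2] and 0 for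
    [|t| >= 3]. *)
Definition plateau t : R := clamp (3 - `|t|).

Definition rV_prod (f : R -> R) u x : R := \prod_i f (x ord0 i - u ord0 i).

Lemma clamp_ge0 t : 0 <= clamp t.
Proof. by rewrite /clamp le_max lexx. Qed.

Lemma clamp_le1 t : clamp t <= 1.
Proof. by rewrite /clamp ge_max ler01 ge_min lexx. Qed.

Lemma clamp_eq0 t : t <= 0 -> clamp t = 0.
Proof. by move=> t0; rewrite /clamp; apply/max_idPl; rewrite ge_min t0 orbT. Qed.

Lemma clamp_eq1 t : 1 <= t -> clamp t = 1.
Proof. by move=> t1; rewrite /clamp (min_idPl t1); apply/max_idPr. Qed.

Lemma continuous_clamp (T : topologicalType) (f : T -> R) :
  continuous f -> continuous (clamp \o f).
Proof.
move=> cf x.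
apply: (@continuous_max _ _ (fun=> 0) ((fun=> 1) \min f)); first exact: cvg_cst.
by apply: continuous_min; [exact: cvg_cst|exact: cf].
Qed.

Lemma continuous_trapezoid n : continuous (trapezoid n).
Proof.
apply: continuous_clamp => x.
apply: (@continuous_min _ _ (fun t => 1 + n.+1%:R * t) (fun t => n.+1%:R * (1 - t))).
  apply: cvgD; first exact: cvg_cst.
  by apply: cvgM; [exact: cvg_cst|exact: cvg_id].
apply: cvgM; first exact: cvg_cst.
by apply: cvgB; [exact: cvg_cst|exact: cvg_id].
Qed.

Lemma continuous_plateau : continuous plateau.
Proof.
apply: continuous_clamp => x; apply: cvgB; first exact: cvg_cst.
exact: norm_continuous.
Qed.

Lemma continuous_rV_prod f u : continuous f -> continuous (rV_prod f u).
Proof.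
move=> cf; apply: continuous_big; first exact: mul_continuous.
move=> i _ x; apply: (@continuous_comp _ _ _ (fun x : E => x ord0 i - u ord0 i) f).
  have ci := @coord_continuous R 1 d ord0 i x.
  exact: (cvgB ci (cvg_cst _)).
exact: cf.
Qed.

Lemma compactly_supported_bounded (phi : E -> R) (M : R) :
  (forall x, phi x != 0 -> `|x| <= M) -> compactly_supported phi.
Proof.
move=> phiM.
have cB : closed [set x : E | `|x| <= M].
  apply: preimage_closed (@closed_le _ M).
  by move=> x _; exact: norm_continuous.
apply: bounded_closed_compact; last exact: closed_closure.
exists M; split; first exact: num_real.
move=> N MN x /= /(closure_subset phiM); rewrite -((closure_id _).1 cB) /=.
by move/le_trans; apply; exact: ltW.
Qed.

Lemma rV_prod_supported f u (M : R) : (forall t, f t != 0 -> `|t| <= M) ->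
  compactly_supported (rV_prod f u).
Proof.
move=> fM; apply: (@compactly_supported_bounded _ (`|u| + Num.max 0 M)) => x.
rewrite prodf_seq_neq0 => /allP fx.
apply/norm_rV_leP => [|i]; first by rewrite addr_ge0// le_max lexx.
have /norm_rV_leP/(_ i) ui := lexx `|u|.
rewrite -[x ord0 i](subrK (u ord0 i)) (le_trans (ler_normD _ _))// addrC lerD//.
  exact: ui.
by rewrite le_max fM ?orbT//; apply: fx; rewrite mem_index_enum.
Qed.

Lemma trapezoid_le_plateau n t : trapezoid n t <= plateau t.
Proof.
have [t2|t2] := leP `|t| 2.
  by rewrite /plateau (@clamp_eq1 (3 - _)) ?clamp_le1//; lra.
rewrite /trapezoid clamp_eq0 ?clamp_ge0//; rewrite ge_min.
have n0 : 0 <= n%:R :> R by [].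
rewrite -natr1; move: t2; rewrite ltr_normr => /orP[t2|t2]; apply/orP; [right|left]; nra.
Qed.

Lemma cvg_trapezoid t :
  trapezoid n t @[n --> \oo] --> (if 0 <= t < 1 then 1 else 0 : R).
Proof.
have ev (y : R) : 0 < y -> \forall n \near \oo, 1 <= n.+1%:R * y.
  move=> y0; near=> n; rewrite -ler_pdivrMr// div1r.
  rewrite -natr1 (@le_trans _ _ n%:R)// ?lerDl//.
  by near: n; exact: nbhs_infty_ger.
have [t0|t0] := ltP t 0 => /=.
  apply: cvg_near_cst; have t0' : 0 < - t by lra.
  near=> n; apply/eqP; rewrite /trapezoid clamp_eq0// ge_min; apply/orP; left.
  by near: n; apply: filterS (ev _ t0') => n; rewrite mulrN; lra.
have [t1|t1] := ltP t 1.
  apply: cvg_near_cst; have t1' : 0 < 1 - t by lra.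
  near=> n; apply/eqP; rewrite /trapezoid clamp_eq1// le_min lerDl mulr_ge0//=.
  by near: n; exact: ev.
apply: cvg_near_cst; near=> n; apply/eqP; rewrite /trapezoid clamp_eq0// ge_min.
by apply/orP; right; rewrite pmulr_rle0//; lra.
Unshelve. all: by end_near. Qed.

Lemma cvg_rV_prod_trapezoid u x :
  rV_prod (trapezoid n) u x @[n --> \oo] --> (\1_(cube u) x : R).
Proof.
rewrite (_ : \1_(cube u) x = \prod_i (if 0 <= x ord0 i - u ord0 i < 1 then 1 else 0)).
  apply: cvg_big => [|i _]; [exact: mul_continuous|exact: cvg_trapezoid].
rewrite indicE; have [xu|xu] := boolP (x \in cube u).
  apply/esym/big1 => i _; rewrite ifT//.
  by move: xu; rewrite inE => /(_ i) /andP[? ?]; apply/andP; split; lra.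
apply/esym/eqP/negPn/negP; rewrite prodf_seq_neq0 => /allP h; move/negP : xu; apply.
rewrite inE => i; have := h i; rewrite mem_index_enum => /(_ isT)/=.
by case: ifPn => [/andP[? ?] _|]; [apply/andP; split; lra|rewrite eqxx].
Qed.

Lemma continuous_measurable_borel (phi : E -> R) : continuous phi ->
  measurable_fun [set: borel E] (fun x => phi x : measurableTypeR R).
Proof.
move=> cphi; apply: (measurability _ (RGenOInfty.measurableE R)).
move=> _ [_ [a ->] <-]; rewrite setTI; apply: borel_open.
by move/continuousP : cphi; apply; exact: interval_open.
Qed.

Lemma cvg_integral_trapezoid mu u :
  (\int[mu]_x (rV_prod plateau u x)%:E < +oo)%E ->
  (\int[mu]_x (rV_prod (trapezoid n) u x)%:E @[n --> \oo] --> mu (cube u))%E.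
Proof.
move=> fin.
have mf (f : R -> R) : continuous f ->
    measurable_fun [set: borel E] (fun x => (rV_prod f u x)%:E).
  move=> cf; apply/measurable_EFinP.
  exact: continuous_measurable_borel (continuous_rV_prod cf).
have p0 x : 0 <= rV_prod plateau u x by apply: prodr_ge0 => i _; exact: clamp_ge0.
have t0 n x : 0 <= rV_prod (trapezoid n) u x.
  by apply: prodr_ge0 => i _; exact: clamp_ge0.
rewrite -[cube u]setIT -(integral_indic mu measurableT (measurable_cube u)).
apply: (@dominated_cvg _ _ _ mu setT _ _ _ (fun x => (rV_prod plateau u x)%:E)) => //.
- by move=> n; exact: mf (@continuous_trapezoid n).
- by move=> x _; apply: cvg_EFin; [exact: nearW|exact: cvg_rV_prod_trapezoid].
- apply/integrableP; split; first exact: mf continuous_plateau.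
  by under eq_integral do rewrite gee0_abs ?lee_fin//.
- move=> n x _; rewrite gee0_abs ?lee_fin//; apply: ler_prod => i _.
  by rewrite clamp_ge0 trapezoid_le_plateau.
Qed.

(** Products of trapezoids converge to the indicator of the cube, under domination by a product of
    plateaus. The dominating integral is finite for [nu] by local finiteness, and then for [mu]
    because the product of plateaus is itself a test function. *)
Lemma measure_cube_eq mu nu u : locally_finite nu ->
  (forall phi : E -> R, continuous phi -> compactly_supported phi ->
    (forall x, 0 <= phi x) ->
    (\int[mu]_x (phi x)%:E = \int[nu]_x (phi x)%:E)%E) ->
  mu (cube u) = nu (cube u).
Proof.
move=> nu_lf munu.
have plateau_supp t : plateau t != 0 -> `|t| <= 3.
  by apply: contraNT; rewrite -ltNge => t3; rewrite /plateau clamp_eq0//; lra.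
have trap_supp n t : trapezoid n t != 0 -> `|t| <= 3.
  move=> tn0; apply: plateau_supp; rewrite gt_eqF//.
  apply: lt_le_trans (trapezoid_le_plateau n t).
  by rewrite lt_neqAle eq_sym tn0 clamp_ge0.
have p0 x : 0 <= rV_prod plateau u x by apply: prodr_ge0 => i _; exact: clamp_ge0.
have nufin : (\int[nu]_x (rV_prod plateau u x)%:E < +oo)%E.
  pose B := [set x : E | `|x| <= `|u| + 3].
  have mB : measurable (B : set (borel E)).
    apply: borel_closed; apply: preimage_closed (@closed_le _ (`|u| + 3)).
    by move=> x _; exact: norm_continuous.
  apply: le_lt_trans (locally_finite_bounded nu_lf mB (fun x Bx => Bx)).
  rewrite -[X in (_ <= nu X)%E]setIT -integral_indic//.
  apply: ge0_le_integral => //.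
  - by move=> x _; rewrite lee_fin.
  - apply/measurable_EFinP.
    exact: continuous_measurable_borel (continuous_rV_prod continuous_plateau).
  - by apply/measurable_EFinP; exact: measurable_indic.
  move=> x _; rewrite lee_fin indicE.
  have [xB|xB] := boolP (x \in B).
    by apply: prodr_ile1 => i _; rewrite clamp_ge0 clamp_le1.
  rewrite le_eqVlt; apply/orP; left; apply: contraNT xB.
  rewrite prodf_seq_neq0 inE => /allP fx /=.
  apply/norm_rV_leP => [|i]; first by rewrite addr_ge0.
  have /norm_rV_leP/(_ i) ui := lexx `|u|.
  rewrite -[x ord0 i](subrK (u ord0 i)) (le_trans (ler_normD _ _))// addrC lerD//.
    exact: ui.
  by apply: plateau_supp; apply: fx; rewrite mem_index_enum.
have mufin : (\int[mu]_x (rV_prod plateau u x)%:E < +oo)%E.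
  rewrite munu//; first exact: continuous_rV_prod continuous_plateau.
  exact: rV_prod_supported plateau_supp.
have cmu := cvg_integral_trapezoid mufin.
have cnu := cvg_integral_trapezoid nufin.
apply: cvg_unique cmu _ => //.
rewrite (_ : (fun n => _) = fun n => (\int[nu]_x (rV_prod (trapezoid n) u x)%:E)%E)//.
apply/funext => n; apply: munu.
- by apply: continuous_rV_prod; exact: continuous_trapezoid.
- by apply: rV_prod_supported; exact: trap_supp.
- by move=> x; apply: prodr_ge0 => i _; exact: clamp_ge0.
Qed.

End marginals.

(** * Cube-to-cube masses of a transportation measure *)

Section extraction.
Variables (R : realType) (d : nat).
Local Notation E := 'rV[R]_d.
Local Notation Z := 'rV[int]_d.
Implicit Types (u v x y : E) (mu nu : {measure set (borel E) -> \bar R}) (k l : Z).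

Definition lat k : E := map_mx intr k.
Definition cell x : Z := map_mx Num.floor x.

Lemma cellP k u x : cell (x - u) = k <-> cube (lat k + u) x.
Proof.
split=> [<- i|xk].
  have := floor_itv ((x - u) ord0 i).
  by rewrite intrD !mxE => /andP[? ?]; apply/andP; split; lra.
apply/rowP => i; rewrite mxE; apply: floor_def; have := xk i.
by rewrite intrD !mxE => /andP[? ?]; apply/andP; split; lra.
Qed.

(** Finite additivity over the fibres of [g], the values outside [s] being taken on a null set. It
    yields the row and column sums of the extracted plan. *)
Lemma measure_fibers (disp : measure_display) (T : measurableType disp)
    (I : choiceType) (mu : {measure set T -> \bar R}) (A : set T) (g : T -> I)
    (s : seq I) :
  measurable A -> (forall i, measurable (g @^-1` [set i])) -> uniq s ->
  (mu A < +oo)%E -> mu (A `&` [set x | g x \notin s]) = 0%E ->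
  \sum_(i <- s) fine (mu (A `&` g @^-1` [set i])) = fine (mu A).
Proof.
move=> mA mg us Afin A0.
have mAg i : measurable (A `&` g @^-1` [set i]) by exact: measurableI.
have tAg : trivIset [set` s] (fun i => A `&` g @^-1` [set i]).
  by move=> i j _ _ [x [[_ /= <-] [_ /= <-]]].
have fin i : mu (A `&` g @^-1` [set i]) \is a fin_num.
  rewrite ge0_fin_numE//; apply: le_lt_trans Afin.
  by apply: le_measure; rewrite ?inE//; exact: subIsetl.
rewrite sum_fine//; congr fine.
rewrite fsbig_seq// -measure_fin_bigcup//.
have mU : measurable (\bigcup_(i in [set` s]) (A `&` g @^-1` [set i])).
  exact: fin_bigcup_measurable.
have AE : A `&` [set x | g x \notin s] =
    A `\` \bigcup_(i in [set` s]) (A `&` g @^-1` [set i]).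
  apply/seteqP; split=> x /= [Ax gx]; split=> //.
    by case=> i /= si [_ /= gi]; rewrite gi si in gx.
  by apply/negP => gs; apply: gx; exists (g x).
rewrite -[in RHS](setUIDK A (\bigcup_(i in [set` s]) (A `&` g @^-1` [set i]))).
rewrite [RHS]measureU//; last 3 first.
- exact: measurableI.
- exact: measurableD.
- by apply/seteqP; split=> // x [[_ ?] []].
rewrite -AE [X in (_ + X)%E]A0 adde0; congr (mu _); apply/seteqP; split=> x.
  by move=> [i si [Ax gi]]; split=> //; exists i.
by case.
Qed.

(** The half-open cube is squeezed between closed boxes of sides [1 - harmonic n] and 1, whose
    volumes come from [lebesgue_rV_box]. *)
Lemma lebesgue_cube u : lebesgue_rV (cube u) = 1%E.
Proof.
pose box (a b : E) := [set v : E | forall i, v ord0 i \in `[a ord0 i, b ord0 i]].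
have mbox a b : measurable (box a b : set (borel E)).
  rewrite (_ : box a b = \bigcap_(i in [set: 'I_d])
      (fun v : E => v ord0 i) @^-1` `[a ord0 i, b ord0 i]).
    apply: fin_bigcap_measurable => // i _.
    apply: borel_closed; apply: preimage_closed; last exact: itv_closed.
    by move=> v _; exact: coord_continuous.
  by apply/seteqP; split=> v /= vB i => [_|]; exact: vB.
have boxE (e : R) : 0 <= e ->
    lebesgue_rV (box u (u + const_mx e)) = (e ^+ d)%:E.
  move=> e0; rewrite lebesgue_rV_box => [|i]; last by rewrite !mxE lerDl.
  rewrite (eq_bigr (fun=> e)) ?prodr_const ?card_ord// => i _.
  by rewrite !mxE addrAC subrr add0r.
have le1 : (lebesgue_rV (cube u) <= 1)%E.
  have := boxE 1 ler01; rewrite expr1n => <-; apply: le_measure; rewrite ?inE.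
  - exact: measurable_cube.
  - exact: mbox.
  by move=> x xu i; rewrite in_itv/= !mxE; have /andP[-> /ltW] := xu i.
have ge n : (((1 - harmonic n) ^+ d)%:E <= lebesgue_rV (cube u))%E.
  have h0 : 0 < harmonic n :> R by exact: harmonic_gt0.
  have h1 : harmonic n <= 1 :> R by rewrite invf_le1// ler1n.
  rewrite -boxE ?subr_ge0//; apply: le_measure; rewrite ?inE.
  - exact: mbox.
  - exact: measurable_cube.
  move=> x xb i; have := xb i; rewrite in_itv/= !mxE => /andP[-> xi] /=.
  by apply: le_lt_trans xi _; rewrite ltrD2l ltrBlDr ltrDl.
have wfin : lebesgue_rV (cube u) \is a fin_num.
  by rewrite ge0_fin_numE//; exact: le_lt_trans le1 (ltry _).
apply/eqP; rewrite eq_le le1/= -(fineK wfin) lee_fin.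
have cvg1 : ((1 - harmonic n) ^+ d) @[n --> \oo] --> (1 : R).
  have h1 : 1 - harmonic n @[n --> \oo] --> (1 : R).
    by rewrite -[X in _ --> X]subr0; apply: cvgB; [exact: cvg_cst|exact: cvg_harmonic].
  rewrite -[X in _ --> X](expr1n _ d).
  exact: (cvg_comp _ _ h1 (@exprn_continuous R d 1)).
rewrite -(cvg_lim (@Rhausdorff R) cvg1); apply: limr_le; first by apply/cvg_ex; exists 1.
by apply: nearW => n; rewrite -lee_fin fineK.
Qed.

Lemma coord_le_enorm x i : `|x ord0 i| <= enorm x.
Proof.
rewrite -sqrtr_sqr ler_wsqrtr// (bigD1 i)//= lerDl.
by apply: sumr_ge0 => j _; exact: sqr_ge0.
Qed.

Lemma pushforward_measure_ex (disp disp' : measure_display) (T : measurableType disp)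
    (T' : measurableType disp') (mu : {measure set T -> \bar R}) (f : T -> T') :
  measurable_fun setT f ->
  exists M : {measure set T' -> \bar R}, M = pushforward mu f :> (set T' -> \bar R).
Proof.
move=> mf.
pose M : {measure set T' -> \bar R} := pushforward mu f.
by exists (M mf).
Qed.

(** The marginal condition says that the pushforward of [gamma] under the first projection
    integrates test functions as [nu1] does, and [measure_cube_eq] passes from test functions to
    cubes. *)
Lemma transportation_fst nu1 nu2 gamma u : locally_finite nu1 ->
  transportation nu1 nu2 gamma ->
  gamma ((fun p => p.1) @^-1` cube u) = nu1 (cube u).
Proof.
move=> lf1 tr.
have [M ME] := pushforward_measure_ex gamma (@measurable_borel_fst R d).
rewrite -(@measure_cube_eq R d M nu1 u)// ?ME// => phi cphi kphi phi0.
rewrite -(tr phi cphi kphi).1 ge0_integral_pushforward//.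
- exact: measurable_borel_fst.
- by apply/measurable_EFinP; exact: continuous_measurable_borel.
- by move=> x _; rewrite lee_fin.
Qed.

Lemma transportation_snd nu1 nu2 gamma u : locally_finite nu2 ->
  transportation nu1 nu2 gamma ->
  gamma ((fun p => p.2) @^-1` cube u) = nu2 (cube u).
Proof.
move=> lf1 tr.
have [M ME] := pushforward_measure_ex gamma (@measurable_borel_snd R d).
rewrite -(@measure_cube_eq R d M nu2 u)// ?ME// => phi cphi kphi phi0.
rewrite -(tr phi cphi kphi).2 ge0_integral_pushforward//.
- exact: measurable_borel_snd.
- by apply/measurable_EFinP; exact: continuous_measurable_borel.
- by move=> x _; rewrite lee_fin.
Qed.

(** In each coordinate, [c] bounds the displacement, [u - v] is the offset of the two grids, and 1
    absorbs the rounding by the two floors. *)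
Lemma cell_near (c : R) (r : nat) u v x y :
  enorm (x - y) < c -> (forall i, c + `|u ord0 i - v ord0 i| + 1 <= r%:R) ->
  near_lattice r (cell (x - u)) (cell (y - v)).
Proof.
move=> xy uvr; apply/forallP => i.
rewrite -(ler_nat R) natr_absz intr_norm rmorphB/= !mxE.
have := floor_itv (x ord0 i - u ord0 i); have := floor_itv (y ord0 i - v ord0 i).
move: (Num.floor _) (Num.floor _) => a b.
have := le_lt_trans (coord_le_enorm (x - y) i) xy; have := uvr i; rewrite !mxE.
rewrite !intrD.
move: (ler_norm (u ord0 i - v ord0 i)) (ler_norm (v ord0 i - u ord0 i)).
rewrite (distrC (v ord0 i)) ltr_norml ler_norml.
move=> ? ? ? /andP[? ?] /andP[? ?] /andP[? ?]; apply/andP; split; lra.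
Qed.

(** The plan records the [gamma]-mass sent from cube [k] of the grid at [u] to cube [l] of the grid
    at [v]. Pairs of cells out of range miss the support, hence carry no mass. *)
Lemma transportation_plan nu1 nu2 gamma (c : R) (r : nat) u v :
  locally_finite nu1 -> locally_finite nu2 ->
  transportation nu1 nu2 gamma -> (displacement gamma < c%:E)%E ->
  (forall i, c + `|u ord0 i - v ord0 i| + 1 <= r%:R) ->
  exists P, plan r (fun k => fine (nu1 (cube (lat k + u))))
    (fun l => fine (nu2 (cube (lat l + v)))) P.
Proof.
move=> lf1 lf2 tr disp_c uvr.
pose A k : set (borel (E * E)) := (fun p => p.1) @^-1` cube (lat k + u).
pose B l : set (borel (E * E)) := (fun p => p.2) @^-1` cube (lat l + v).
have mA k : measurable (A k).
  rewrite -[A k]setTI; apply: measurable_borel_fst => //; exact: measurable_cube.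
have mB l : measurable (B l).
  rewrite -[B l]setTI; apply: measurable_borel_snd => //; exact: measurable_cube.
have AE k : A k = (fun p => cell (p.1 - u)) @^-1` [set k].
  by apply/seteqP; split=> p /cellP.
have BE l : B l = (fun p => cell (p.2 - v)) @^-1` [set l].
  by apply/seteqP; split=> p /cellP.
have nA k : gamma (A k) = nu1 (cube (lat k + u)) by exact: transportation_fst tr.
have nB l : gamma (B l) = nu2 (cube (lat l + v)) by exact: transportation_snd tr.
have fin nu w : locally_finite nu -> (nu (cube w) < +oo)%E.
  move=> lf; apply: (locally_finite_bounded lf (measurable_cube w)) => x.
  exact: cube_norm.
have far p : ~~ near_lattice r (cell (p.1 - u)) (cell (p.2 - v)) ->
    ~ msupport gamma p.
  move=> np sp; move/negP : np; apply; apply: cell_near uvr.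
  rewrite -lte_fin; apply: le_lt_trans disp_c; rewrite /displacement le_max.
  apply/orP; right; apply: ereal_sup_ubound; exists p => //.
  exact: subset_closure.
have null (F : set (borel (E * E))) : measurable F ->
    (forall p, F p -> ~~ near_lattice r (cell (p.1 - u)) (cell (p.2 - v))) ->
    gamma F = 0%E.
  by move=> mF Ff; apply: msupport_null => // p /Ff /far.
exists (fun k l => fine (gamma (A k `&` B l))); split.
- by move=> k l; exact: fine_ge0.
- move=> k l; apply: contraNT => nkl; rewrite null//; first exact: measurableI.
  by move=> p; rewrite AE BE => -[/= -> ->].
(* [A k] is split according to the cell of the second point; the cells outside the ball around [k]
   contribute a null set. *)
- move=> k; rewrite -nA; under eq_bigr do rewrite BE.
  rewrite measure_fibers//.
  + by move=> l; rewrite -BE.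
  + exact: zball_uniq.
  + by rewrite nA fin.
  rewrite null//.
  + rewrite [X in _ `&` X](_ : _ = ~` \bigcup_(l in [set` zball r k]) B l).
      apply: measurableI => //; apply: measurableC.
      by apply: fin_bigcup_measurable => //.
    apply/seteqP; split=> p /=.
      by move=> pk [l /= kl]; rewrite BE /= => pl; rewrite pl kl in pk.
    by move=> h; apply/negP => pk; apply: h; exists (cell (p.2 - v)) => //; rewrite BE.
  + by move=> p; rewrite AE => -[/= ->]; rewrite mem_zball.
- move=> l; rewrite -nB; under eq_bigr do rewrite AE setIC.
  rewrite measure_fibers//.
  + by move=> k; rewrite -AE.
  + exact: zball_uniq.
  + by rewrite nB fin.
  rewrite null//.
  + rewrite [X in _ `&` X](_ : _ = ~` \bigcup_(k in [set` zball r l]) A k).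
      apply: measurableI => //; apply: measurableC.
      by apply: fin_bigcup_measurable => //.
    apply/seteqP; split=> p /=.
      by move=> pk [k /= kl]; rewrite AE /= => pl; rewrite pl kl in pk.
    by move=> h; apply/negP => pk; apply: h; exists (cell (p.1 - u)) => //; rewrite AE.
  + by move=> p; rewrite BE => -[/= ->]; rewrite mem_zball near_lattice_sym.
Qed.

End extraction.

(** * From plans to transportation measures *)

Section realisation.
Variables (R : realType) (d : nat).
Local Notation E := 'rV[R]_d.
Local Notation Z := 'rV[int]_d.
Implicit Types (u v x y : E) (mu nu : {measure set (borel E) -> \bar R}) (k l : Z).
Local Open Scope ereal_scope.

Lemma locally_finite_sigma_finite nu : locally_finite nu ->
  exists m : {sigma_finite_measure set (borel E) -> \bar R},
    nu = m :> (set (borel E) -> \bar R).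
Proof.
move=> lf.
have nu_ball (e : R) : nu (ball (0%R : E) e) < +oo.
  apply: (@locally_finite_bounded _ _ nu _ e) => //.
    by apply: borel_open; exact: ball_open.
  by move=> x; rewrite -ball_normE /= sub0r normrN => /ltW.
have sf := ball_fin_sigma_finite nu_ball.
pose H2 := isSFinite.Build _ _ _ _ (sfinite_measure_sigma_finite sf).
pose H3 := isSigmaFinite.Build _ _ _ _ sf.
by exists (HB.pack_for {sigma_finite_measure set (borel E) -> \bar R}
  (Measure.sort nu) H2 H3).
Qed.

Lemma cell_cube k x : cell x = k <-> cube (lat R k) x.
Proof. by have := cellP k 0 x; rewrite subr0 addr0. Qed.

Lemma measurable_cell k : measurable ((@cell R d) @^-1` [set k] : set (borel E)).
Proof.
rewrite (_ : _ @^-1` _ = cube (lat R k)); first exact: measurable_cube.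
by apply/seteqP; split=> x /cell_cube.
Qed.

Lemma measurable_cells (B : set Z) : measurable ((@cell R d) @^-1` B : set (borel E)).
Proof.
rewrite (_ : _ @^-1` B =
  \bigcup_k (if `[< B k >] then (@cell R d) @^-1` [set k] else set0)).
  apply: countable_bigcupT_measurable; first exact: countableP.
  by move=> k; case: ifP => _ //; exact: measurable_cell.
apply/seteqP; split=> x /= => [Bx|[k _]]; last by case: ifPn => // /asboolP + ->.
by exists (cell x) => //; rewrite ifT//; exact/asboolP.
Qed.

(** There are countably many cells, so every preimage is a countable union of products of measurable
    sets, whatever [f] is. *)
Lemma measurable_cell_fun (disp : measure_display) (T : measurableType disp)
    (f : Z -> Z -> T) :
  measurable_fun [set: borel E * borel E] (fun p => f (cell p.1) (cell p.2)).
Proof.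
move=> _ B _; rewrite setTI.
rewrite (_ : _ @^-1` B = \bigcup_k ((@cell R d) @^-1` [set k] `*`
    (@cell R d) @^-1` [set l | B (f k l)])).
  apply: countable_bigcupT_measurable; first exact: countableP.
  by move=> k; apply: measurableX; exact: measurable_cells.
by apply/seteqP; split=> p /= => [Bp|[k _ [/= -> //]]]; exists (cell p.1).
Qed.

(** Integrating the density over the cube [l] cancels the factor [b l], and the row sum [a k]
    cancels the other one. When [a k] is zero, the convention [0^-1 = 0] gives the value 0. *)
Lemma plan_density_integral nu (r : nat) (a : Z -> R) P :
  locally_finite nu -> plan r a (fun l => fine (nu (cube (lat R l)))) P ->
  forall k, \int[nu]_y (P k (cell y) / (a k * fine (nu (cube (lat R (cell y))))))%:E =
    (a k != 0%R)%:R%:E.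
Proof.
move=> lf PP k; have [P0 Pn Pa Pb] := PP; set b := fun l => fine (nu (cube (lat R l))).
have bE l : nu (cube (lat R l)) = (b l)%:E.
  rewrite fineK// ge0_fin_numE//.
  by apply: (locally_finite_bounded lf (measurable_cube _)) => x; exact: cube_norm.
have b0 l : (0 <= b l)%R by exact: fine_ge0.
have a0 : (0 <= a k)%R by rewrite -Pa sumr_ge0.
pose c l := (P k l / (a k * b l))%R.
have c0 l : (0 <= c l)%R by rewrite divr_ge0// mulr_ge0.
rewrite (_ : (fun y => _) = fun y => \sum_(l <- zball r k) (c l * \1_(cube (lat R l)) y)%:E).
  rewrite ge0_integral_sum//; last 2 first.
  - move=> l; apply/measurable_EFinP; apply: measurable_funM => //.
    exact: measurable_indic (measurable_cube _).
  - by move=> l y _; rewrite lee_fin mulr_ge0.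
  transitivity ((\sum_(l <- zball r k) P k l / a k)%R%:E).
    rewrite -sumEFin; apply: eq_bigr => l _.
    rewrite (@integralZl_indic _ _ _ nu setT measurableT (fun=> cube (lat R l)))//; last 2 first.
    - by rewrite ltNge c0.
    - exact: measurable_cube.
    rewrite integral_indic//; last exact: measurable_cube.
    rewrite setIT bE -EFinM; congr (_%:E); rewrite /c.
    (* A null target cube receives nothing, so [P k l] is zero there and the division by zero loses
       no mass. *)
    have [bl|bl] := eqVneq (b l) 0%R.
      have := plan_le l k (plan_sym PP); rewrite -/(b l) bl => Pkl.
      by rewrite mulr0 (@le_anti _ _ (P k l) 0%R) ?mul0r// Pkl P0.
    by rewrite invfM mulrA mulfVK.
  rewrite -mulr_suml Pa; have [->|ak] := eqVneq (a k) 0%R; first by rewrite mul0r.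
  by rewrite mulfV.
apply/funext => y; rewrite -/(b _) -/(c _) sumEFin; congr (_%:E).
have [Pky|Pky] := eqVneq (P k (cell y)) 0%R.
  rewrite /c Pky mul0r big1// => l _; rewrite indicE.
  have [yl|] := boolP (y \in _); last by rewrite mulr0.
  by move: yl; rewrite inE => /cell_cube <-; rewrite Pky !mul0r.
rewrite (bigD1_seq (cell y)) ?zball_uniq ?mem_zball ?Pn//=.
rewrite indicE mem_set ?mulr1; last exact/cell_cube.
rewrite big1 ?addr0// => l ly; rewrite indicE memNset ?mulr0//.
by move=> /cell_cube yl; rewrite yl eqxx in ly.
Qed.


(** The indicator removes the cubes of mass zero, a countable union of null sets. This is the outer
    integral that Tonelli leaves in [plan_coupling]. *)
Lemma plan_support nu r (b : Z -> R) P : locally_finite nu ->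
  plan r (fun k => fine (nu (cube (lat R k)))) b P ->
  forall A : set (borel E), measurable A ->
  \int[nu]_(x in A) (fine (nu (cube (lat R (cell x)))) != 0%R)%:R%:E = nu A.
Proof.
move=> lf PP A mA; set a := fun k => fine (nu (cube (lat R k))).
pose N := [set x : E | a (cell x) != 0%R].
have mN : measurable (N : set (borel E)) by exact: (measurable_cells [set k | a k != 0%R]).
rewrite (_ : (fun x => _) = fun x => (\1_N x)%:E); last first.
  by apply/funext => x; rewrite indicE mem_setE.
rewrite integral_indic//.
rewrite -[in RHS](setUIDK A N) measureU//; last 3 first.
- exact: measurableI.
- exact: measurableD.
- by apply/seteqP; split=> // x [[_ ?] []].
rewrite setIC [X in _ + X](_ : _ = 0) ?adde0//.
apply: (@countable_null_cover _ _ _ nu _ _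
  (fun k => if a k == 0%R then cube (lat R k) else set0)).
- exact: measurableD.
- by move=> k; case: ifP => _ //; exact: measurable_cube.
- move=> k; case: ifPn => [/eqP ak|_]; last exact: measure0.
  rewrite -[LHS]fineK -/(a k) ?ak// ge0_fin_numE//.
  by apply: (locally_finite_bounded lf (measurable_cube _)) => x; exact: cube_norm.
move=> x [_ /negP]; rewrite negbK => xN; exists (cell x) => //.
by rewrite xN; apply/cell_cube.
Qed.

(** Inside each pair of cubes the mass [P k l] is spread as the normalised product of [m1] and [m2];
    normalising separately on each cube is what restores the two marginals exactly. *)
Lemma plan_coupling (m1 m2 : {sigma_finite_measure set (borel E) -> \bar R}) r P :
  locally_finite m1 -> locally_finite m2 ->
  plan r (fun k => fine (m1 (cube (lat R k)))) (fun l => fine (m2 (cube (lat R l)))) P ->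
  exists gamma : {measure set (borel (E * E)) -> \bar R},
    [/\ forall A : set (borel E), measurable A -> gamma ((fun p => p.1) @^-1` A) = m1 A,
        forall A : set (borel E), measurable A -> gamma ((fun p => p.2) @^-1` A) = m2 A &
        gamma [set p : E * E | (r.+1%:R < `|p.1 - p.2|)%R] = 0].
Proof.
move=> lf1 lf2 PP; have [P0 Pn _ _] := PP.
set a := fun k => fine (m1 (cube (lat R k))).
set b := fun l => fine (m2 (cube (lat R l))).
have a0 k : (0 <= a k)%R by exact: fine_ge0.
have b0 l : (0 <= b l)%R by exact: fine_ge0.
(* As [0^-1 = 0], the density vanishes over null cubes. *)
pose W (p : borel E * borel E) : \bar R :=
  (P (cell p.1) (cell p.2) / (a (cell p.1) * b (cell p.2)))%R%:E.
have W0 p : 0 <= W p by rewrite lee_fin divr_ge0// mulr_ge0.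
have mW : measurable_fun [set: _] W.
  exact: (measurable_cell_fun (fun k l => (P k l / (a k * b l))%R%:E)).
have mE (A : set (borel (E * E))) : measurable A ->
    measurable (A : set (borel E * borel E)).
  by move=> mA; have := @measurable_prod_borel R d measurableT A mA; rewrite setTI.
pose G (A : set (borel (E * E))) := \int[m1 \x m2]_(p in A) W p.
have G0 : G set0 = 0 by exact: integral_set0.
have G_ge0 A : 0 <= G A by apply: integral_ge0.
have G_sigma : semi_sigma_additive G.
  move=> F mF tF mUF; rewrite /G ge0_integral_bigcup//.
  - apply: is_cvg_ereal_nneg_natsum_cond => n _ _; exact: integral_ge0.
  - by move=> k; exact: mE.
  - exact: measurable_funTS.
pose gamma : {measure set (borel (E * E)) -> \bar R} :=
  HB.pack G (isMeasure.Build _ _ _ G G0 G_ge0 G_sigma).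
have mWD (D : set (borel E * borel E)) : measurable D -> measurable_fun [set: _] (W \_ D).
  by move=> mD; apply: (measurable_restrictT _ mD).1; apply: measurable_funTS.
exists gamma; split=> [A mA|A mA|].
(* Tonelli: the inner integral is given by [plan_density_integral], the outer one by
   [plan_support]. *)
- rewrite -(plan_support lf1 PP mA) /= /G integral_mkcond fubini_tonelli1.
  + rewrite [RHS]integral_mkcond; apply: eq_integral => x _.
    rewrite /fubini_F /patch; case: ifPn => xA; last first.
      apply: integral0_eq => y _; rewrite ifF//; apply: contraNF xA.
      by rewrite !inE.
    rewrite -(plan_density_integral lf2 PP); apply: eq_integral => y _.
    by rewrite ifT// inE; rewrite inE in xA.
  + apply: mWD; rewrite (_ : _ @^-1` _ = A `*` setT); first exact: measurableX.
    by apply/seteqP; split=> p //= -[].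
  + by apply: erestrict_ge0.
- rewrite -(plan_support lf2 (plan_sym PP) mA) /= /G integral_mkcond fubini_tonelli2.
  + rewrite [RHS]integral_mkcond; apply: eq_integral => y _.
    rewrite /fubini_G /patch; case: ifPn => yA; last first.
      apply: integral0_eq => x _; rewrite ifF//; apply: contraNF yA.
      by rewrite !inE.
    rewrite -(plan_density_integral lf1 (plan_sym PP)); apply: eq_integral => x _.
    by rewrite ifT /W ?[(b _ * _)%R]mulrC// inE; rewrite inE in yA.
  + apply: mWD; rewrite (_ : _ @^-1` _ = setT `*` A); first exact: measurableX.
    by apply/seteqP; split=> p //= -[].
  + by apply: erestrict_ge0.
(* Where the density is nonzero the floors differ by at most [r] in each coordinate, hence the
   points by at most [r.+1]. *)
- apply: integral0_eq => -[x y] /= xy; rewrite /W /=.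
  have [->|/Pn/forallP xyn] := eqVneq (P (cell x) (cell y)) 0%R; first by rewrite mul0r.
  exfalso; move: xy; rewrite ltNge => /negP; apply; apply/norm_rV_leP => // i.
  have := xyn i; rewrite -(ler_nat R) natr_absz intr_norm rmorphB/= !mxE.
  have := floor_itv (x ord0 i); have := floor_itv (y ord0 i).
  rewrite !intrD -natr1 !ler_norml.
  by move=> /andP[? ?] /andP[? ?] /andP[? ?]; apply/andP; split; lra.
Qed.

Lemma marginal_integral (disp : measure_display) (T : measurableType disp)
    (gamma : {measure set T -> \bar R}) nu (g : T -> borel E) (phi : E -> R) :
  measurable_fun [set: T] g ->
  (forall A : set (borel E), measurable A -> gamma (g @^-1` A) = nu A) ->
  continuous phi ->
  \int[gamma]_p (phi (g p))%:E = \int[nu]_x (phi x)%:E.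
Proof.
move=> mg gnu cphi.
have mphi : measurable_fun [set: borel E] (fun x : borel E => (phi x)%:E).
  by apply/measurable_EFinP; exact: continuous_measurable_borel.
have [M ME] := pushforward_measure_ex gamma mg.
have pos (f : borel E -> \bar R) : measurable_fun setT f -> (forall x, 0 <= f x) ->
    \int[gamma]_p f (g p) = \int[nu]_x f x.
  move=> mf f0; rewrite -(@eq_measure_integral _ _ _ setT nu M); last first.
    by move=> A mA _; rewrite ME /pushforward gnu.
  by rewrite ME ge0_integral_pushforward.
rewrite integralE [RHS]integralE; congr (_ - _).
- rewrite -(pos (fun x : borel E => (phi x)%:E)^\+)//.
    by apply: eq_integral => p _; rewrite !funeposE.
  exact: measurable_funepos.
- rewrite -(pos (fun x : borel E => (phi x)%:E)^\-)//.
    by apply: eq_integral => p _; rewrite !funenegE.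
  exact: measurable_funeneg.
Qed.

(** The Euclidean norm of a vector with all [d] coordinates equal to [r.+1]. *)
Definition plan_radius (r : nat) : R := Num.sqrt (d%:R * r.+1%:R ^+ 2).

Lemma enorm_le x (c : R) : (`|x| <= c -> enorm x <= Num.sqrt (d%:R * c ^+ 2))%R.
Proof.
move=> xc; rewrite ler_wsqrtr//.
rewrite mulr_natl -[X in (_ <= _ *+ X)%R](card_ord d) -sumr_const.
apply: ler_sum => i _; rewrite -real_normK ?num_real// lerXn2r ?nnegrE//.
  exact: le_trans xc.
by have /norm_rV_leP/(_ i) := xc; apply; exact: le_trans xc.
Qed.

(** The coupling of [plan_coupling] is a competitor in the infimum, and its sup-norm displacement
    bound is converted to the Euclidean norm. *)
Lemma plan_Tra (nu1 nu2 : {measure set (borel E) -> \bar R}) r P :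
  locally_finite nu1 -> locally_finite nu2 ->
  plan r (fun k => fine (nu1 (cube (lat R k)))) (fun l => fine (nu2 (cube (lat R l)))) P ->
  Tra nu1 nu2 <= (plan_radius r)%:E.
Proof.
move=> lf1 lf2 PP.
have [m1 E1] := locally_finite_sigma_finite lf1.
have [m2 E2] := locally_finite_sigma_finite lf2.
rewrite E1 E2 in PP lf1 lf2.
have [gamma [g1 g2 far]] := plan_coupling lf1 lf2 PP.
apply: (@le_trans _ _ (displacement gamma)).
  apply: ereal_inf_lbound; exists gamma => // phi cphi _; split.
    apply: marginal_integral => //; first exact: measurable_borel_fst.
    by move=> A mA; rewrite g1 ?E1.
  apply: marginal_integral => //; first exact: measurable_borel_snd.
  by move=> A mA; rewrite g2 ?E2.
rewrite /displacement ge_max lee_fin sqrtr_ge0/=.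
apply: ge_ereal_sup => _ [p sp <-]; rewrite lee_fin; apply: enorm_le.
have cD : closed [set p : E * E | (`|p.1 - p.2| <= r.+1%:R)%R].
  apply: (@preimage_closed _ _ (fun p : E * E => `|p.1 - p.2|%R) _ _ (@closed_le _ (r.+1%:R : R))).
  by move=> q _; exact: (cvg_norm (cvgB cvg_fst cvg_snd)).
have : closure [set p : E * E | (`|p.1 - p.2| <= r.+1%:R)%R] p.
  (* The set of pairs further apart than [r.+1] is open and null, so it contains no point of the
     support. *)
  apply: closure_subset sp => q sq /=; rewrite leNgt; apply/negP => rq.
  have := sq [set p : E * E | (r.+1%:R < `|p.1 - p.2|)%R].
  rewrite far ltxx => h; suff: false by []; apply: h; split=> //.
  rewrite (_ : [set _ | _] = ~` [set p : E * E | (`|p.1 - p.2| <= r.+1%:R)%R]).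
    by rewrite openC.
  by apply/seteqP; split=> p' /=; rewrite ltNge => /negP.
by rewrite -((closure_id _).1 cD).
Qed.

End realisation.

(** * Uniformly spread measures *)

Section uniformly_spread.
Variables (R : realType) (d : nat).
Local Notation E := 'rV[R]_d.
Implicit Types (nu : {measure set (borel E) -> \bar R}) (z : E).

Lemma translate_cube nu z (w : E) : translate nu z (cube w) = nu (cube (w - z)).
Proof.
rewrite /translate /pushforward; congr (nu _); apply/seteqP.
by split=> x xw i; have := xw i; rewrite !mxE => /andP[? ?]; apply/andP; split; lra.
Qed.

Lemma translate_locally_finite nu z : locally_finite nu -> locally_finite (translate nu z).
Proof.
move=> lf x; have [U [oU Ux] Ufin] := lf (x - z).
exists ((fun y : E => y - z) @^-1` U).
  split=> //; apply: open_comp oU => y _.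
  exact: (@cvgB _ E _ (nbhs y) _ id (fun=> z) y z cvg_id (cvg_cst _)).
rewrite /translate /pushforward (_ : _ @^-1` _ = U)//.
by apply/seteqP; split=> y /=; rewrite addrK.
Qed.

Lemma mscale_lebesgue_locally_finite (b : {nonneg R}) :
  locally_finite (mscale b (@lebesgue_rV R d)).
Proof.
move=> x; exists (ball (0 : E) (`|x| + 1)).
  split; first exact: ball_open.
  by rewrite -ball_normE /= sub0r normrN ltrDl.
rewrite /mscale lte_mul_pinfty// ?lee_fin//; exact: lebesgue_rV_ball_fin.
Qed.

Lemma mscale_lebesgue_cube (b : {nonneg R}) (w : E) :
  mscale b (@lebesgue_rV R d) (cube w) = b%:num%:E.
Proof. by rewrite -[RHS]mule1; congr (_ * _)%E; exact: lebesgue_cube. Qed.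

Lemma Tra_lt (nu1 nu2 : {measure set (borel E) -> \bar R}) (c : R) :
  (Tra nu1 nu2 < c%:E)%E ->
  exists2 gamma, transportation nu1 nu2 gamma & (displacement gamma < c%:E)%E.
Proof. by move/ereal_inf_lt => [_ [gamma tr <-] gc]; exists gamma. Qed.

(** A single [gamma] is discretised on two grids, at 0 and at [- z]. Every grid cube has the same
    mass [beta] for the scaled Lebesgue measure, and the [nu]-masses on the second grid are the
    masses of [translate nu z] on the first. The radius does not depend on [z]. *)
Lemma uniformly_spread_Tra_translate nu : locally_finite nu -> uniformly_spread nu ->
  exists C : R, forall z : E, (Tra nu (translate nu z) < C%:E)%E.
Proof.
move=> lf [beta nu_beta].
have [c nu_c] : exists c : R,
    (Tra nu (mscale (beta%:num%:nng)%R (@lebesgue_rV R d)) < c%:E)%E.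
  move: nu_beta; case: Tra => [t _| |] //; last by exists 0; exact: ltNyr.
  by exists (t + 1); rewrite lte_fin ltrDl.
have [gamma tr gc] := Tra_lt nu_c.
pose r := (Num.truncn (c + 1)).+1.
have cr (i : 'I_d) (u : E) : c + `|u ord0 i - u ord0 i| + 1 <= r%:R.
  by rewrite subrr normr0 addr0; apply: ltW; exact: truncnS_gt.
have lf_beta : locally_finite (mscale (beta%:num%:nng)%R (@lebesgue_rV R d)).
  exact: mscale_lebesgue_locally_finite.
have bE u : (fun l : 'rV[int]_d =>
    fine (mscale (beta%:num%:nng)%R (@lebesgue_rV R d) (cube (lat R l + u)))) =
    fun=> beta%:num.
  by apply/funext => l; rewrite mscale_lebesgue_cube.
have plan_u u : exists P,
    plan r (fun k => fine (nu (cube (lat R k + u)))) (fun=> beta%:num) P.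
  have := transportation_plan (u := u) (v := u) lf lf_beta tr gc (fun i => cr i u).
  by rewrite bE.
(* Gluing adds the two radii; the extra 1 makes the inequality strict. *)
exists (plan_radius R d (r + r) + 1) => z.
have [P0 PP0] := plan_u 0; have [Pz PPz] := plan_u (- z).
have [G PG] := plan_glue (gt0 beta) PP0 PPz.
apply: (@le_lt_trans _ _ (plan_radius R d (r + r))%:E); last by rewrite lte_fin ltrDl.
apply: (@plan_Tra _ _ _ _ _ G) => //; first exact: translate_locally_finite.
rewrite (_ : (fun k => fine (nu _)) = fun k => fine (nu (cube (lat R k + 0)))).
  rewrite (_ : (fun k => fine (translate _ _ _)) =
    fun k => fine (nu (cube (lat R k - z))))//.
  by apply/funext => k; rewrite translate_cube.
by apply/funext => k; rewrite addr0.
Qed.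

Lemma Tra_translate_uniformly_spread nu : locally_finite nu ->
  ~ (forall A : set (borel E), measurable A -> nu A = 0%E) ->
  (exists C : R, forall z : E, (Tra nu (translate nu z) < C%:E)%E) ->
  uniformly_spread nu.
Proof.
move=> lf nu0 [C nuC].
pose a k := fine (nu (cube (lat R k))).
pose r := (Num.truncn (C + 1)).+1.
(* Translating by [- lat R z] turns the cube masses [a k] into [a (k + z)]. *)
have aa : shift_reachable r a a.
  move=> z; have [gamma tr gC] := Tra_lt (nuC (- lat R z)).
  have [|P] := transportation_plan (u := 0) (v := 0) (r := r) lf
    (translate_locally_finite (- lat R z) lf) tr gC.
    by move=> i; rewrite subrr normr0 addr0; apply: ltW; exact: truncnS_gt.
  rewrite (_ : (fun k => fine (nu _)) = a); last first.
    by apply/funext => k; rewrite addr0.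
  rewrite (_ : (fun k => fine (translate _ _ _)) = fun k => a (k + z)).
    by exists P.
  by apply/funext => k; rewrite addr0 translate_cube opprK /a /lat map_mxD.
have a0 k : 0 <= a k by exact: fine_ge0.
(* The unit cubes cover the space, so a nonzero [nu] charges one of them. *)
have [k0 ak0] : exists k, 0 < a k.
  apply: contrapT => /forallNP na; apply: nu0 => A mA.
  apply: (@countable_null_cover _ _ _ nu A _ (fun k => cube (lat R k))) => //.
  - by move=> k; exact: measurable_cube.
  - move=> k; have /negP := na k; rewrite -leNgt => ak.
    have /eqP : a k = 0 by apply: le_anti; rewrite ak a0.
    rewrite fine_eq0; first by move/eqP.
    rewrite ge0_fin_numE//.
    by apply: (locally_finite_bounded lf (measurable_cube _)) => x; exact: cube_norm.
  by move=> x _; exists (cell x) => //; exact/cell_cube.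
have [b [P [b0 PP]]] := shift_reachable_const a0 ak0 aa.
exists (PosNum b0); apply: le_lt_trans (ltry (plan_radius R d r)).
apply: (@plan_Tra _ _ _ _ _ P) => //; first exact: mscale_lebesgue_locally_finite.
rewrite (_ : (fun l => fine (mscale _ _ _)) = fun=> b)//.
by apply/funext => l; rewrite mscale_lebesgue_cube.
Qed.

End uniformly_spread.

Theorem theorem1 (R : realType) (d : nat)
    (nu : {measure set (borel 'rV[R]_d) -> \bar R})
    (nu_lf : locally_finite nu)
    (nu_neq0 : ~ (forall A : set (borel 'rV[R]_d), measurable A -> nu A = 0%E)) :
  uniformly_spread nu <->
  exists C : R, forall z : 'rV[R]_d, (Tra nu (translate nu z) < C%:E)%E.
Proof.
split; first exact: uniformly_spread_Tra_translate.
exact: Tra_translate_uniformly_spread.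
Qed.
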